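(* Let $G$ be a right-topological group which has countable tightness and a rich family of Baire subspaces. Let $X$ be a space such that $X\times X$ is countably compact and completely regular. If $\pi\colon G\times X\to X$ is a separately continuous left action of $G$ on $X$, then $\pi$ is jointly continuous (i.e., $G\curvearrowright_\pi X$ is a topological flow) and $G$ is Baire.
   Context: No separation axioms are assumed unless stated. A right-topological group is a group with a topology such that every right translation $x\mapsto xs$ is continuous. A space $S$ has countable tightness if for each $A\subseteq S$ and $p\in\overline{A}$ there is a countable $C\subseteq A$ with $p\in\overline{C}$. Let $\mathcal{S}_{\mathrm{cl}}(S)$ be the family of non-void closed separable subspaces of $S$. A subfamily $\mathcal{F}\subseteq\mathcal{S}_{\mathrm{cl}}(S)$ is a rich family for $S$ if every $A\in\mathcal{S}_{\mathrm{cl}}(S)$ is contained in some $F\in\mathcal{F}$ and $\overline{\bigcup_n F_n}\in\mathcal{F}$ for every increasing sequence $\{F_n\}_{n=1}^\infty$ in $\mathcal{F}$; it is a rich family of Baire subspaces if each member is a Baire space (no non-void open subset is meager) in the subspace topology. A space is countably compact if every countable open cover has a finite subcover. Completely regular (not necessarily $T_1$): for every point $x$ and neighborhood $U$ of $x$ there is a continuous $[0,1]$-valued function vanishing at $x$ and equal to $1$ off $U$. A left action $\pi\colon G\times X\to X$, $(t,x)\mapsto tx$, satisfies $ex=x$ and $(st)x=s(tx)$; it is separately continuous if $\pi$ is continuous in each variable when the other is fixed. *)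

(* Defs.v *)
From HB Require Import structures.
From mathcomp Require Import all_boot all_order all_algebra.
From mathcomp Require Import all_classical all_reals all_analysis.

Set Implicit Arguments.
Unset Strict Implicit.
Unset Printing Implicit Defensive.

Import Order.TTheory GRing.Theory Num.Theory.
Import numFieldNormedType.Exports.

Local Open Scope classical_set_scope.
Local Open Scope ring_scope.

#[short(type="preTopologicalGroupType")]
HB.structure Definition PreTopologicalGroup :=
  {G of Topological G & monoid.Group G}.

HB.mixin Record PreTopologicalGroup_isRightTopologicalGroup G
    & PreTopologicalGroup G := {
  mulgr_continuous : forall s : G, continuous (fun x : G => (x * s)%g)
}.

#[short(type="rightTopologicalGroupType")]
HB.structure Definition RightTopologicalGroup :=
  {G of PreTopologicalGroup G & PreTopologicalGroup_isRightTopologicalGroup G}.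

Definition countably_tight (T : topologicalType) :=
  forall (A : set T) (p : T), closure A p ->
    exists C : set T, [/\ countable C, C `<=` A & closure C p].

Definition separable_space (T : topologicalType) :=
  exists2 D : set T, countable D & dense D.

Definition nowhere_dense (T : topologicalType) (A : set T) :=
  interior (closure A) = set0.

Definition meager (T : topologicalType) (A : set T) :=
  exists2 N : nat -> set T, (forall n, nowhere_dense (N n)) &
    A = \bigcup_n N n.

Definition baire_space (T : topologicalType) :=
  forall U : set T, open U -> U !=set0 -> ~ meager U.

(* A set used as a space is its subtype [set_type A], whose topology is induced
   by the inclusion; [subspace A] would add the points outside of A. *)
Definition closed_separable (T : topologicalType) (A : set T) :=
  [/\ A !=set0, closed A & separable_space (set_type A)].

Definition rich_family (T : topologicalType) (F : set (set T)) :=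
  [/\ F `<=` @closed_separable T,
      forall A, closed_separable A -> exists2 B, F B & A `<=` B &
      forall B : nat -> set T, (forall n, F (B n)) ->
        (forall n, B n `<=` B n.+1) -> F (closure (\bigcup_n B n))].

Definition rich_family_of_Baire_subspaces (T : topologicalType)
    (F : set (set T)) :=
  rich_family F /\ forall A, F A -> baire_space (set_type A).

Definition countably_compact (T : topologicalType) :=
  forall C : set (set T), countable C -> C `<=` open ->
    \bigcup_(A in C) A = setT ->
    exists D : set (set T),
      [/\ D `<=` C, finite_set D & \bigcup_(A in D) A = setT].

(* The library's [completely_regular_space] is the equivalent property phrased
   with entourages instead of real-valued functions. *)
Definition completely_regular (R : realType) (T : topologicalType) :=
  forall (x : T) (U : set T), nbhs x U ->
    exists f : T -> R, [/\ continuous f, forall y, 0 <= f y <= 1, f x = 0 &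
      forall y, ~ U y -> f y = 1].

Definition left_action (G : groupType) (X : Type) (pi : G * X -> X) :=
  (forall x, pi (1%g, x) = x) /\
  (forall s t x, pi ((s * t)%g, x) = pi (s, pi (t, x))).

Definition separately_continuous (X Y Z : topologicalType) (f : X * Y -> Z) :=
  (forall x, continuous (fun y => f (x, y))) /\
  (forall y, continuous (fun x => f (x, y))).

(* Main.v *)
Require Import Defs.
From HB Require Import structures.
From mathcomp Require Import all_boot all_order all_algebra.
From mathcomp Require Import all_classical all_reals all_analysis.
From mathcomp Require Import lra.

(** Both conclusions come from passing to a well-chosen separable piece of [G].

    Closing off ([rich_closing_off]). Countable tightness says that each
    instance of a point lying in the closure of a set is witnessed by countably
    many points. Alternately adding such witnesses for countably many instances
    and enlarging into the rich family, [omega] times, yields a countable set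
    [D] whose closure belongs to the rich family, hence is Baire, and which
    witnesses all the instances about points of [D]. This plays the role of a
    countable elementary submodel.

    [G] is Baire ([baire_rich_family]). Close off under membership in the
    closures of countably many given dense open sets: their traces on the
    closure of [D] are then dense there, and the closure of [D] is Baire.

    Joint continuity. Fix a continuous [f : X -> R] and consider the separately
    continuous map [h t x = f (t x)]. The crux is that some [t] has, at every
    point of [{t} x X], oscillation of [h] at most [e] ([joint_oscillation]).
    Suppose every [t] has a bad point [y t]. Close off under the statements
    that, arbitrarily near [t], some [r] and some [x] near [y t] have [h r x]
    far from [h t (y t)], where nearness to [y t] is measured by finitely many
    of the functions [h d], [d] in [D]. Countable compactness of [X x X] makes
    each [h t], with [t] in the closure of [D], uniformly continuous with
    respect to finitely many [h d] ([uniform_control]); so the closure of [D]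
    is a countable union of closed sets on each of which this uniform
    continuity has a fixed modulus. By the Baire property one of them contains
    a nonempty open piece, and a bad point at some [t] of [D] in that piece
    contradicts equicontinuity.

    Finally, right translations transport this single [t] to all of [G]: since
    [u x = (u g^-1) (g x)], the behaviour of the action at [(t0, x0)] is its
    behaviour at [(t0 g^-1, g x0)], and [g = t^-1 t0] moves [t0] to [t]. With
    [f] vanishing at [t0 x0] and equal to 1 off a neighborhood [W], oscillation
    less than 1 keeps the action inside [W]. *)

Set Implicit Arguments.
Unset Strict Implicit.
Unset Printing Implicit Defensive.

Import Order.TTheory GRing.Theory Num.Theory.
Import numFieldNormedType.Exports.

Local Open Scope classical_set_scope.
Local Open Scope ring_scope.

(** * Countable and separable sets *)

Lemma countable_range_nat (T : Type) (D : set T) :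
  countable D -> D !=set0 -> exists d : nat -> T, range d = D.
Proof.
move=> /countable_injP [f finj] [p Dp].
have /choice [d dP] : forall n, exists x,
    D x /\ forall y, D y -> f y = n -> x = y.
  move=> n; have [[x [Dx fx]]|nx] := pselect (exists x, D x /\ f x = n).
    by exists x; split=> // y Dy fy; apply: finj; rewrite ?inE // fx fy.
  by exists p; split=> // y Dy fy; case: nx; exists y.
exists d; apply/seteqP; split=> [_ [n _ <-]|y Dy]; first by case: (dP n).
by exists (f y) => //; case: (dP (f y)) => _; apply.
Qed.

Lemma countableU (T : Type) (A B : set T) :
  countable A -> countable B -> countable (A `|` B).
Proof.
move=> cA cB; rewrite -bigcup2E; apply: bigcup_countable => // -[|[|n]] _ //=.
Qed.

Lemma closed_separable_closure (T : topologicalType) (B : set T) :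
  countable B -> B !=set0 -> closed_separable (closure B).
Proof.
move=> cB B0; have [d dB] := countable_range_nat cB B0.
have Bd n : closure B (d n).
  by apply: subset_closure; rewrite -dB; exists n.
split; first by exists (d 0%N).
- exact: closed_closure.
exists (range (fun n => exist _ (d n) (mem_set (Bd n)) : closure B)).
  exact: sub_countable (card_image_le _ _) (countableP _).
move=> O [[x xB] Ox] [V oV VO]; rewrite -VO /= set_valE /= in Ox *.
have [y [By Vy]] : B `&` V !=set0.
  by move: (set_mem xB); apply; exact: open_nbhs_nbhs.
have [n _ dn] : range d y by rewrite dB.
exists (exist _ (d n) (mem_set (Bd n))).
by split; [rewrite /= dn | exists n].
Qed.

Lemma closed_separable_countable (T : topologicalType) (A : set T) :
  closed_separable A -> exists2 B : set T, countable B & closure B = A.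
Proof.
move=> [_ cA [D cD dD]]; exists (set_val @` D).
  exact: sub_countable (card_image_le _ _) cD.
apply/seteqP; split=> [|a Aa V].
  move/closure_id: cA => cA; rewrite [X in _ `<=` X]cA; apply: closure_subset.
  by move=> _ [[x xA] _ <-]; exact: set_mem.
rewrite nbhsE => -[W [oW Wa] WV].
have [|x [Wx Dx]] := dD (set_val @^-1` W) _ (ex_intro2 _ _ W oW erefl).
  by exists (exist _ a (mem_set Aa)).
by exists (set_val x); split; [exists x | exact: WV].
Qed.

(** * Closing off inside a rich family *)

(** [E a s n] is an arbitrary family of sets indexed by a point, finitely many
    parameters and a natural number; only countably many of them have their
    indices in a given countable set, which is why [D] can absorb witnesses for
    all of them. Finite sequences of parameters cause no trouble at the limit:
    they already lie in some stage of the construction. *)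
Lemma rich_closing_off (T : topologicalType) (F : set (set T))
    (E : T -> seq T -> nat -> set T) (p : T) :
  countably_tight T -> rich_family F ->
  exists D : set T, [/\ countable D, D p, F (closure D) &
    forall a s n, D a -> {in s, forall x, D x} -> closure (E a s n) a ->
      closure (E a s n `&` D) a].
Proof.
move=> tT [Fsep Fcof Fchain].
have /choice [C CP] : forall z : T * seq T * nat, exists C : set T,
    [/\ countable C, C `<=` E z.1.1 z.1.2 z.2 &
      closure (E z.1.1 z.1.2 z.2) z.1.1 -> closure C z.1.1].
  move=> [[a s] n] /=.
  have [/tT [C [cC CE Ca]]|nE] := pselect (closure (E a s n) a).
    by exists C.
  by exists set0; split=> //; exact: countable0.
(* [B'] is an admissible next stage after [B]: the chosen witnesses for all
   instances with indices in [B] are in [B']. *)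
pose good (B B' : set T) := [/\ countable B', B `<=` B', F (closure B') &
  forall a s n, B a -> {in s, forall x, B x} -> C (a, s, n) `<=` B'].
have step B : exists B', countable B -> B !=set0 -> good B B'.
  have [[cB B0]|nB] := pselect (countable B /\ B !=set0); last first.
    by exists B => cB B0; case: nB.
  have [d dB] := countable_range_nat cB B0.
  pose B1 := B `|` \bigcup_(z in [set: nat * seq nat * nat])
    C (d z.1.1, map d z.1.2, z.2).
  have cB1 : countable B1.
    apply: countableU => //; apply: bigcup_countable => // z _.
    by case: (CP (d z.1.1, map d z.1.2, z.2)).
  (* The next stage is made dense in a member of the rich family, so that the
     closures of the stages form an increasing sequence in that family. *)
  have [|H FH B1H] := Fcof _ (closed_separable_closure cB1 _).
    by case: B0 => x Bx; exists x; left.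
  have [B2 cB2 B2H] := closed_separable_countable (Fsep _ FH).
  have clH : closure (B1 `|` B2) = H.
    rewrite closureU B2H; apply/seteqP; split=> [x []//|x Hx]; last by right.
    exact: B1H.
  exists (B1 `|` B2) => _ _; split.
  - exact: countableU.
  - by move=> x Bx; left; left.
  - by rewrite clH.
  move=> a s n Ba Bs x Cx; left; right.
  have [i _ di] : range d a by rewrite dB.
  have [t ts] : exists t, map d t = s.
    elim: s Bs {Cx} => [|y s IHs] Bs; first by exists [::].
    have [|t ts] := IHs.
      by move=> z zs; apply: Bs; rewrite inE zs orbT.
    have [j _ dj] : range d y by rewrite dB; apply: Bs; rewrite inE eqxx.
    by exists (j :: t) => /=; rewrite dj ts.
  by exists (i, t, n) => //=; rewrite di ts.
have /choice [g gP] := step.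
(* Starting from an iterate of [g] rather than from the singleton puts every
   closure of a stage in the family. *)
pose B k := iter k.+1 g [set p].
have B0 k : countable (B k) /\ B k !=set0.
  elim: k => [|k [cB Bk]].
    have [|| cB /(_ p erefl) Bp _ _] := gP [set p].
    - exact: countable1.
    - by exists p.
    - by split=> //; exists p.
  have [cB' BB' _ _] := gP _ cB Bk.
  by split=> //; case: Bk => x Bx; exists x; exact: BB'.
have Bg k : good (B k) (B k.+1) by case: (B0 k); exact: gP.
have Bmono : {homo B : i j / (i <= j)%N >-> i `<=` j}.
  apply: homo_leq => [X|X Y Z XY YZ x /XY/YZ//|k]; first by [].
  by case: (Bg k).
exists (\bigcup_k B k); split.
- by apply: bigcup_countable => // k _; case: (B0 k).
- exists 0%N => //; have [||_ + _ _] := gP [set p].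
  + exact: countable1.
  + by exists p.
  + by move=> /(_ p); apply.
- have -> : closure (\bigcup_k B k) = closure (\bigcup_k closure (B k.+1)).
    apply/seteqP; split.
      apply: closure_subset => x [k _ Bx]; exists k => //.
      by apply: subset_closure; apply: (Bmono k).
    have /closure_id -> := @closed_closure T (\bigcup_k B k).
    apply: closure_subset => x [k _ Bx]; apply: closure_subset Bx => y By.
    by exists k.+1.
  apply: Fchain => k; first by case: (Bg k).
  by apply: closure_subset; apply: Bmono.
move=> a s n [i _ Ba] Bs Ea.
have [j Bsj] : exists j, {in s, forall x, B j x}.
  elim: s Bs {Ea} => [|y s IHs] Bs; first by exists 0%N.
  have [|j js] := IHs.
    by move=> z zs; apply: Bs; rewrite inE zs orbT.
  have [|k _ Bk] := Bs y; first by rewrite inE eqxx.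
  exists (maxn j k) => z; rewrite inE => /orP [/eqP ->|/js].
    by apply: Bmono Bk; exact: leq_maxr.
  by apply: Bmono; exact: leq_maxl.
have [_ _ _ /(_ a s n)] := Bg (maxn i j).
have [_ CE Ca] := CP (a, s, n).
move=> CB; apply: closure_subset (Ca Ea) => x Cx; split; first exact: CE.
exists (maxn i j).+1 => //; apply: CB => //.
  by apply: Bmono Ba; exact: leq_maxl.
by move=> z /Bsj; apply: Bmono; exact: leq_maxr.
Qed.

(** A nowhere dense set [N n] has a dense complement of its closure; closing
    off under this density makes the trace of [N n] on the closure of [D]
    nowhere dense in that Baire subspace. *)
Lemma baire_rich_family (T : topologicalType) (F : set (set T)) :
  countably_tight T -> rich_family_of_Baire_subspaces F -> baire_space T.
Proof.
move=> tT [rF bF] U oU [p Up] [N ndN UN].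
have [D [cD Dp FD DP]] :=
  rich_closing_off (fun _ _ n => ~` closure (N n)) p tT rF.
apply: (bF _ FD (set_val @^-1` U)).
- by exists U.
- by exists (exist _ p (mem_set (subset_closure Dp))).
exists (fun n => set_val @^-1` N n) => [n|]; last by rewrite UN preimage_bigcup.
apply/seteqP; split=> // x.
rewrite /interior /= nbhsE => -[_ [[W oW <-] Wx] WN].
have [a [Da Wa]] : D `&` W !=set0.
  by case: x Wx => x xD /= Wx; move: (set_mem xD); apply; exact: open_nbhs_nbhs.
have dense_compl : closure (~` closure (N n)) a.
  move=> V Va; apply: contrapT => VN.
  have : (closure (N n))° a.
    apply: filterS Va => y Vy; apply: contrapT => Ny.
    by apply: VN; exists y.
  by rewrite ndN.
have [b [[Nb Db] Wb]] : (~` closure (N n) `&` D) `&` W !=set0.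
  by apply: (DP a [::] n) => //; exact: open_nbhs_nbhs.
apply: Nb => V Vb.
have /(WN (exist _ b (mem_set (subset_closure Db)))) bN : W b by [].
have [|y [Ny Vy]] := bN (set_val @^-1` V); last first.
  by exists (set_val y).
exact: initial_continuous.
Qed.

(** * Separately continuous functions and countable compactness *)

Lemma countably_compact_increasing (T : topologicalType) (O : nat -> set T) :
  countably_compact T -> (forall k, open (O k)) ->
  {homo O : i j / (i <= j)%N >-> i `<=` j} -> \bigcup_k O k = setT ->
  exists k, O k = setT.
Proof.
move=> cT oO Omono OT.
have [||| D [DO /finite_seqP [s Ds] DT]] := cT (range O).
- exact: sub_countable (card_image_le _ _) (countableP _).
- by move=> _ [k _ <-].
- by rewrite bigcup_image.
have [k sk] : exists k, {in s, forall A, A `<=` O k}.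
  have : {in s, forall A, range O A} by move=> A As; apply: DO; rewrite Ds.
  elim: s {Ds} => [|A s IHs] sO; first by exists 0%N.
  have [|i si] := IHs; first by move=> B Bs; apply: sO; rewrite inE Bs orbT.
  have [|j _ OA] := sO A; first by rewrite inE eqxx.
  exists (maxn i j) => B; rewrite inE => /orP[/eqP ->|/si].
    by rewrite -OA; apply: Omono; exact: leq_maxr.
  by move=> BO x /BO; apply: Omono; exact: leq_maxl.
exists k; apply/seteqP; split=> // x _.
have : (\bigcup_(A in D) A) x by rewrite DT.
by rewrite Ds => -[A As]; exact: sk.
Qed.

Lemma near_dist (R : realType) (T : topologicalType) (f : T -> R)
    (x : T) (e : R) :
  continuous f -> 0 < e -> \forall y \near x, `|f y - f x| < e.
Proof.
by move=> cf e0; near do rewrite distrC; move/cvgrPdist_lt: (cf x); apply.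
Unshelve. all: by end_near. Qed.

(** This is uniform continuity of [h t] for the pseudometrics given by the
    [h (d i)]. Two points not separated by any [h (d i)] are not separated by
    [h t] either, because [t] is a limit of the [d i]; so the open sets on which
    [h t] varies by less than [e], or some [h (d i)] with [i <= k] varies by
    more than [1 / (k + 1)], increase with [k] and cover [X * X]. *)
Lemma uniform_control (R : realType) (T X : topologicalType)
    (h : T -> X -> R) (d : nat -> T) (t : T) (e : R) :
  countably_compact (X * X)%type -> (forall s, continuous (h s)) ->
  (forall x, continuous (h^~ x)) -> closure (range d) t -> 0 < e ->
  exists k, forall x y,
    (forall i, (i <= k)%N -> `|h (d i) x - h (d i) y| <= k.+1%:R^-1) ->
    `|h t x - h t y| < e.
Proof.
move=> cX hX hT dt e0.
pose g s (p : X * X) := `|h s p.1 - h s p.2|.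
have cg s : continuous (g s).
  move=> p; apply: cvg_norm; apply: cvgB.
    by apply: continuous_comp; [exact: cvg_fst|exact: hX].
  by apply: continuous_comp; [exact: cvg_snd|exact: hX].
pose O k := g t @^-1` [set r | r < e] `|`
  \bigcup_(i in `I_k.+1) g (d i) @^-1` [set r | k.+1%:R^-1 < r].
have [|||k Ok] := @countably_compact_increasing _ O cX.
- move=> k; apply: openU.
    by apply: open_comp; [move=> ? _; exact: cg|exact: open_lt].
  apply: bigcup_open => i _.
  by apply: open_comp; [move=> ? _; exact: cg|exact: open_gt].
- move=> i j ij p [ge|[l /= li gl]]; first by left.
  right; exists l; first exact: leq_trans li _.
  apply: le_lt_trans gl; rewrite lef_pV2 ?posrE ?ltr0n // ler_nat.
  by rewrite ltnS.
- apply/seteqP; split=> // -[x y] _.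
  have [ge|ge] := ltP (g t (x, y)) e; first by exists 0%N => //; left.
  have e3 : 0 < e / 3 by lra.
  have [_ [[i _ <-] [hx hy]]] := dt _ (filterI (near_dist t (hT x) e3)
    (near_dist t (hT y) e3)).
  have [m me] : exists m : nat, m.+1%:R^-1 < e / 3.
    by have [m _ mP] := near_infty_natSinv_lt (PosNum e3); exists m;
      exact: mP (leqnn m).
  exists (maxn i m) => //; right; exists i; first by rewrite /= ltnS leq_maxl.
  have : (maxn i m).+1%:R^-1 <= m.+1%:R^-1 :> R.
    by rewrite lef_pV2 ?posrE ?ltr0n // ler_nat ltnS leq_maxr.
  rewrite /g /= in ge hx hy *.
  have tri1 := ler_distD (h (d i) x) (h t x) (h t y).
  have tri2 := ler_distD (h (d i) y) (h (d i) x) (h t y).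
  rewrite [X in _ <= X + _]distrC in tri1.
  move=> km; apply: le_lt_trans km (lt_trans me _).
  lra.
exists k => x y hk; have : O k (x, y) by rewrite Ok.
by case=> // -[i /= ik]; rewrite ltNge; case/negP; exact: hk.
Qed.

(** A Baire category argument on the closure of a countable set [D] obtained by
    closing off under the failure of the conclusion. It takes place on the
    closure of [D] because there countably many functions [h d] control all the
    others; closing off ensures that the failure is still visible there. *)
Lemma joint_oscillation (R : realType) (T X : topologicalType)
    (F : set (set T)) (h : T -> X -> R) (e : R) (p : T) :
  countably_tight T -> rich_family_of_Baire_subspaces F ->
  countably_compact (X * X)%type -> (forall s, continuous (h s)) ->
  (forall x, continuous (h^~ x)) -> 0 < e ->
  exists t, forall y, \forall q \near (t, y), `|h q.1 q.2 - h t y| < e.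
Proof.
move=> tT [rF bF] cX hX hT e0; apply: contrapT => nt.
have /choice [y yP] : forall t, exists y,
    ~ \forall q \near (t, y), `|h q.1 q.2 - h t y| < e.
  by move=> t; apply/existsNP => ty; apply: nt; exists t.
(* Neighborhoods of [y t] are restricted to those defined by finitely many
   parameters and a bound, which is what closing off can handle. *)
pose E t (s : seq T) (n : nat) := [set r | exists x,
  (forall u, u \in s -> `|h u x - h u (y t)| <= n.+1%:R^-1) /\
  e <= `|h r x - h t (y t)|].
have closureE t s n : closure (E t s n) t.
  move=> V Vt.
  have Wy : \forall x \near y t,
      forall u, u \in s -> `|h u x - h u (y t)| <= n.+1%:R^-1.
    elim: s => [|u s IHs]; first by near=> x.
    have n0 : 0 < n.+1%:R^-1 :> R by rewrite invr_gt0 ltr0n.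
    near=> x => v; rewrite inE => /orP[/eqP ->|].
      by apply: ltW; near: x; exact: near_dist.
    by move: v; near: x.
  apply: contrapT => EV; apply: (yP t).
  exists (V, [set x | forall u, u \in s -> `|h u x - h u (y t)| <= n.+1%:R^-1]).
    by split.
  move=> [r x] [/= Vr sx]; rewrite ltNge; apply/negP => ex.
  by apply: EV; exists r; split=> //; exists x.
have [D [cD Dp FD DP]] := rich_closing_off E p tT rF.
have [d dD] := countable_range_nat cD (ex_intro _ p Dp).
have e3 : 0 < e / 3 by lra.
pose N k := [set t : closure D | forall x y,
  (forall i, (i <= k)%N -> `|h (d i) x - h (d i) y| <= k.+1%:R^-1) ->
  `|h (set_val t) x - h (set_val t) y| <= e / 3].
have clN k : closed (N k).
  rewrite (_ : N k = \bigcap_(q in [set q : X * X | forall i, (i <= k)%N ->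
      `|h (d i) q.1 - h (d i) q.2| <= k.+1%:R^-1])
      [set t : closure D |
        `|h (set_val t) q.1 - h (set_val t) q.2| <= e / 3]).
    apply: closed_bigI => q _.
    have hD x : continuous (fun t : closure D => h (set_val t) x).
      move=> t; apply: (@continuous_comp _ _ _ set_val (h^~ x)).
        exact: initial_continuous.
      exact: hT.
    have gD : continuous (fun t : closure D =>
        `|h (set_val t) q.1 - h (set_val t) q.2|).
      move=> t; exact: (cvg_norm (cvgB (hD q.1 t) (hD q.2 t))).
    exact: (@closed_comp _ _ _ [set r : R | r <= e / 3]
      (fun t _ => gD t) (@closed_le _ _)).
  apply/seteqP; split=> [t Nt [x z] /= hq|t Nt x z hq]; first exact: Nt.
  exact: (Nt (x, z)).
have [k nk] : exists k, ~ nowhere_dense (N k).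
  apply/existsNP => ndN; apply: (bF _ FD setT openT).
    by exists (exist _ p (mem_set (subset_closure Dp))).
  exists N => //; apply/seteqP; split=> // -[t tD] _.
  have [|k kP] := @uniform_control R _ _ h d t (e / 3) cX hX hT _ e3.
    by rewrite dD; exact: set_mem.
  by exists k => // x z /kP /ltW.
have /set0P [u] : (closure (N k))° != set0 by apply/eqP.
have /closure_id <- := clN k.
rewrite /interior /= nbhsE => -[_ [[W oW <-] Wu] WN].
have [t [Dt Wt]] : D `&` W !=set0.
  by case: u Wu => u uD /= Wu; move: (set_mem uD); apply; exact: open_nbhs_nbhs.
have dDn i : D (d i) by rewrite -dD; exists i.
(* The witness [r] lies in [D], hence in the domain of [N k], and the parameters
   [d 0, ..., d k] defining [x] near [y t] are those of the modulus in [N k]. *)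
have [||r [[[x [xs ex]] Dr] [Wr ry]]] :=
  DP t [seq d i | i <- iota 0 k.+1] k Dt _
    (closureE _ _ _) (W `&` [set r | `|h r (y t) - h t (y t)| < e / 3]).
- by move=> _ /mapP [i _ ->].
- by apply: filterI; [exact: open_nbhs_nbhs|exact: (near_dist t (hT (y t)))].
have /(WN (exist _ r (mem_set (subset_closure Dr)))) /= rN : W r by [].
have := rN x (y t) _; move: ex ry => /= ex ry.
have := ler_distD (h r (y t)) (h r x) (h t (y t)).
move=> tri /(_ _) rx.
have {}rx : `|h r x - h r (y t)| <= e / 3.
  by apply: rx => i ik; apply: xs; apply: map_f; rewrite mem_iota.
lra.
Unshelve. all: by end_near. Qed.

(** * The action *)

Lemma completely_regular_square (R : realType) (X : topologicalType) :
  completely_regular R (X * X)%type -> completely_regular R X.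
Proof.
move=> crX x U Ux; have [|f [cf f01 fx fU]] := crX (x, x) (U `*` setT).
  by exists (U, setT) => //; split=> //; exact: filterT.
exists (fun y => f (y, x)); split=> //.
- move=> y; apply: (@continuous_comp _ _ _ (fun y => (y, x)) f); last exact: cf.
  by apply: cvg_pair; [exact: cvg_id|exact: cvg_cst].
- by move=> y nUy; apply: fU => -[].
Qed.

Theorem theorem4p1p11 (R : realType) (G : rightTopologicalGroupType)
    (X : topologicalType) (pi : G * X -> X) :
  countably_tight G ->
  (exists F : set (set G), rich_family_of_Baire_subspaces F) ->
  countably_compact (X * X)%type ->
  completely_regular R (X * X)%type ->
  left_action pi ->
  separately_continuous pi ->
  continuous pi /\ baire_space G.
Proof.
move=> tG [F FG] cX crX [pi1 piM] [piX piG].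
split; last exact: baire_rich_family FG.
move=> [t0 x0] W Wz.
have [f [cf f01 fz fW]] := completely_regular_square crX Wz.
pose h t x := f (pi (t, x)).
have hX t : continuous (h t).
  by move=> x; apply: continuous_comp; [exact: piX|exact: cf].
have hG x : continuous (h^~ x).
  by move=> t; apply: continuous_comp; [exact: piG|exact: cf].
(* The value 1 for the oscillation is the gap of [f] between [t0 x0] and the
   points off [W]. *)
have [t tP] := joint_oscillation 1%g tG FG cX hX hG (@ltr01 R).
pose g := (t^-1 * t0)%g.
have tg : (t0 * g^-1)%g = t by rewrite /g invgM invgK mulgA mulgV mul1g.
have [[U V] [/= Ut Vy] UV] := tP (pi (g, x0)).
have ht : h t (pi (g, x0)) = 0 by rewrite /h -piM /g mulVKg.
exists ([set u | U (u * g^-1)%g], [set x | V (pi (g, x))]) => /=.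
  split.
    have gU : nbhs (t0 * g^-1)%g U by rewrite tg.
    exact: (@mulgr_continuous G g^-1%g t0 U gU).
  exact: piX.
move=> [u x] [/= Uu Vx]; apply: contrapT => nW.
have := UV (u * g^-1, pi (g, x))%g (conj Uu Vx).
by rewrite /= ht subr0 /h -piM mulgVK fW // normr1 ltxx.
Qed.
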